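(* For every integer $h\ge 0$, there exist a real number $r<1$ and an integer $D\ge 1$ such that for every integer $d\ge D$ there is a finite family $\mathcal{F}=\mathcal{F}(h,d)$ of bottomless rectangles such that the following holds. For any hitting set $H\subseteq\mathcal{F}$ of the $d$-cells of $\mathcal{F}$, there is a vertical line $\ell$ such that $|\ell\cap\mathcal{F}|\le\lceil rd\rceil$ and $|\ell\cap H|\ge h$.
   Context: A (closed) bottomless rectangle is a subset of $\mathbb{R}^2$ of the form $\{(x,y): l\le x\le r,\ y\le t\}$. For a finite family $\mathcal{F}$ of bottomless rectangles, the $d$-cells of $\mathcal{F}$ are the cells of the arrangement consisting of points covered by exactly $d$ members of $\mathcal{F}$. A subset $H\subseteq\mathcal{F}$ is a hitting set of the $d$-cells of $\mathcal{F}$ if every point of $\mathbb{R}^2$ that is covered by exactly $d$ members of $\mathcal{F}$ is covered by at least one member of $H$. For a vertical line $\ell$ and a family $\mathcal{G}$ of bottomless rectangles, $\ell\cap\mathcal{G}$ denotes the set of members of $\mathcal{G}$ that intersect $\ell$. *)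

(* Defs.v *)
From mathcomp Require Import all_boot all_order all_algebra finmap.
From mathcomp Require Import boolp classical_sets reals.

Set Implicit Arguments.
Unset Strict Implicit.
Unset Printing Implicit Defensive.

Import Order.TTheory GRing.Theory Num.Theory.

Local Open Scope classical_set_scope.
Local Open Scope ring_scope.

(* Rectangles are point sets rather than triples (l, r, t), so a family never
   contains the same rectangle twice. *)
Definition bottomless_rectangle (R : realType) (A : set (R * R)) : Prop :=
  exists l r t : R, A = [set p | l <= p.1 <= r /\ p.2 <= t].

Definition vertical_line (R : realType) (a : R) : set (R * R) :=
  [set p | p.1 = a].

Definition members_covering (R : realType) (F : {fset set (R * R)})
    (p : R * R) : {fset set (R * R)} :=
  [fset A in F | p \in A]%fset.

Definition members_meeting (R : realType) (L : set (R * R))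
    (F : {fset set (R * R)}) : {fset set (R * R)} :=
  [fset A in F | `[< L `&` A !=set0 >]]%fset.

(* The union of the d-cells of F. *)
Definition d_cells (R : realType) (d : nat) (F : {fset set (R * R)}) :
    set (R * R) :=
  [set p | #|` members_covering F p| = d].

Definition hits_d_cells (R : realType) (d : nat)
    (F H : {fset set (R * R)}) : Prop :=
  (H `<=` F)%fset /\
  forall p, d_cells d F p -> exists2 A, A \in H & A p.

(* Main.v *)
Require Import Defs.
From mathcomp Require Import all_boot all_order all_algebra finmap.
From mathcomp Require Import boolp classical_sets reals.
From mathcomp Require Import zify lra.

Set Implicit Arguments.
Unset Strict Implicit.
Unset Printing Implicit Defensive.

Import Order.TTheory GRing.Theory Num.Theory.

Local Open Scope classical_set_scope.
Local Open Scope ring_scope.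

(** The construction is by induction on [h]: a family [F(h, d)] is found such
    that every hitting set has [h] members on some line that meets at most
    [d - d %/ N] rectangles, where [N] depends only on [h]; then [r = 1 - 1/N]
    works.

    For [h + 1], let exactly [d] rectangles meet a vertical line at [c], so that
    one of them must be hit. The [e = d %/ (2 * N)] lowest ones form a bundle:
    they extend to the right of [c], all over the same slot, and a copy of
    [F(h, d)] stands in this slot, higher than the bundle. The other rectangles
    end at [c] and extend to the left, the higher the longer. Call [I_j] the
    [j]-th rectangle from the bottom, for [e < j <= d]. Each [I_j] extends
    further left than everything below it, and over this extra stretch stands a
    copy of [F(h, j)], higher than [I_j] and lower than [I_(j+1)].

    Let [I] be the highest hit rectangle on the line at [c].
    - If [I = I_j], then the [d - j] rectangles above it are not hit, so the
      points covered by these and by exactly [j] members of the copy over [I_j]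
      are hit within the copy. This gives a line with [h] hits from the copy,
      and [I_j] is one more. The line meets [d - j] long rectangles, [I_j], and
      at most [j - j %/ N] members of the copy. Since [j > e], this is at most
      [d + 1 - e %/ N].
    - If [I] is in the bundle, the copy on the right is disjoint from all
      rectangles above the bundle, so it is forced to have a line with [h] hits.
      The bundle adds at least one hit and [e] rectangles, which is affordable
      because [e] is only about half of the deficit [d %/ N] of the copy.

    Both lines meet at most [d - d %/ (4 * N ^ 2)] rectangles when [d] is large.

    Lemma [staircase_exists] builds the left part from the bottom up,
    [forcing_step] adds the copy on the right, [forcing_exists] fixes the
    constants. Rectangles are handled as triples in a duplicate-free sequence,
    hitting sets as predicates on triples; the translation to point sets is
    made at the very end. *)

(** * Families of triples and forced lines *)

Definition left_end (R : realType) (q : R * R * R) : R := q.1.1.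
Definition right_end (R : realType) (q : R * R * R) : R := q.1.2.
Definition height (R : realType) (q : R * R * R) : R := q.2.

Definition meets (R : realType) (a : R) : pred (R * R * R) :=
  fun q => left_end q <= a <= right_end q.

Definition covers (R : realType) (x y : R) : pred (R * R * R) :=
  fun q => meets x q && (y <= height q).

Definition located (R : realType) (x0 x1 y0 : R) (q : R * R * R) : Prop :=
  [/\ x0 < left_end q, left_end q <= right_end q, right_end q < x1
    & y0 < height q].

(** Only the points above abscissas in [I] and higher than [y0] need to be hit.
    This makes the notion local: it can be checked on a piece of a larger
    family, where other rectangles lie lower or elsewhere. *)
Definition hits_depth (R : realType) (I : pred R) (y0 : R) (d : nat)
    (s : seq (R * R * R)) (P : pred (R * R * R)) : Prop :=
  forall x y, x \in I -> y0 < y -> count (covers x y) s = d ->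
    has (predI P (covers x y)) s.

(** The number [g] is the deficit of the line: how far it stays below [d].
    Deficits are convenient because they survive when one more rectangle
    covers the line and [d] grows by one. *)
Definition rich_line (R : realType) (I : pred R) (h d g : nat)
    (s : seq (R * R * R)) (P : pred (R * R * R)) : Prop :=
  exists a, [/\ a \in I, (count (meets a) s + g <= d)%N
              & (h <= count (predI P (meets a)) s)%N].

(** The family [F(h, d)] of the induction, squeezed into a prescribed slot: the
    abscissas lie in the open interval from [x0] to [x1] and the heights above
    [y0]. Having it in every slot spares any rescaling of families. *)
Definition forcing (R : realType) (x0 x1 y0 : R) (h d g : nat)
    (s : seq (R * R * R)) : Prop :=
  [/\ uniq s, (forall q, q \in s -> located x0 x1 y0 q)
    & forall P, hits_depth (mem `]x0, x1[) y0 d s P ->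
        rich_line (mem `]x0, x1[) h d g s P].

(** * The staircase to the left *)

Lemma count0_in (T : eqType) (p : pred T) (s : seq T) :
  (forall q, q \in s -> ~~ p q) -> count p s = 0%N.
Proof.
move=> h; apply/eqP; rewrite -leqn0 leqNgt -has_count.
by apply/hasPn.
Qed.

Lemma countT_in (T : eqType) (p : pred T) (s : seq T) :
  (forall q, q \in s -> p q) -> count p s = size s.
Proof. by move=> h; apply/eqP; rewrite -all_count; apply/allP. Qed.

Lemma exists_above (R : realType) (y0 : R) (s : seq (R * R * R)) :
  exists2 y, y0 < y & forall q, q \in s -> height q < y.
Proof.
elim: s => [|q s [y hy hs]]; first by exists (y0 + 1) => //; lra.
exists (y + `|height q - y| + 1); first by have := normr_ge0 (height q - y); lra.
move=> q'; rewrite inE => /orP[/eqP ->|/hs];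
  have := normr_ge0 (height q - y); have := ler_norm (height q - y); lra.
Qed.

(** The lowest [e] rectangles through the central line. They have equal ends, and
    their distinct heights serve only to make them distinct. *)
Definition bundle (R : realType) (c v y0 : R) (e : nat) : seq (R * R * R) :=
  [seq (c, v, y0 + i.+1%:R) | i <- iota 0 e].

Lemma bundleP (R : realType) (c v y0 : R) (e : nat) q :
  q \in bundle c v y0 e ->
  [/\ left_end q = c, right_end q = v & y0 + 1 <= height q].
Proof.
case/mapP => i _ -> /=; split => //; rewrite /height /=.
by rewrite lerD2l ler1n.
Qed.

Lemma bundle_uniq (R : realType) (c v y0 : R) (e : nat) :
  uniq (bundle c v y0 e).
Proof.
rewrite map_inj_uniq ?iota_uniq // => i j [] /addrI /eqP.
by rewrite eqr_nat => /eqP [].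
Qed.

(** The part of the construction above abscissas at most [c], cut down to the [j]
    lowest rectangles through the central line and the copies attached to them.
    The other [d - j] central rectangles will cover all of it, so it has to
    answer only to hitting sets of its points of depth [j]. A hit in the bundle
    [low] is left as an open alternative, to be exploited on the right of [c]. *)
Definition staircase (R : realType) (p c y0 : R) (h j g : nat)
    (low T : seq (R * R * R)) : Prop :=
  [/\ uniq (T ++ low), (forall q, q \in T ->
        [/\ p < left_end q, left_end q <= right_end q, right_end q <= c
          & y0 < height q])
    & forall P, hits_depth (mem `]p, c]) y0 j (T ++ low) P ->
        has P low \/ rich_line (mem `]p, c[) h j g (T ++ low) P].

(** The line at [c], just above [y0], is covered by the bundle only. *)
Lemma staircase0 (R : realType) (p c v y0 : R) (h e g : nat) :
  p < c -> c <= v -> staircase p c y0 h e g (bundle c v y0 e) [::].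
Proof.
move=> pc cv; split => //=; first exact: bundle_uniq.
move=> P /(_ c (y0 + 1)); rewrite inE /= in_itv /= pc lexx => /(_ isT).
have -> : y0 < y0 + 1 by lra.
move=> /(_ isT) hit; left.
have /hit : count (covers c (y0 + 1)) (bundle c v y0 e) = e.
  rewrite countT_in ?size_map ?size_iota // => q /bundleP [lq rq hq].
  by rewrite /covers /meets lq rq lexx cv.
by apply: sub_has => q /= /andP[].
Qed.

(** Adding one step: the new rectangle [I] is higher and longer than everything so
    far, and [C] stands on it over the slot from [p'] to [p''] that only [I]
    reaches. If [I] is hit, the copy [C], which sees nothing else above [I],
    provides [h] more hits. If [I] is not hit, it merely raises by one the depth
    of all points of the smaller staircase, which has to answer in turn. *)
Lemma staircase_step (R : realType) (p p' p'' c v y0 : R) (h j g G e : nat) T :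
  p < p' -> p' < p'' -> p'' < c -> c <= v -> (0 < j)%N -> (g < G)%N ->
  (forall z0, exists C, forcing p' p'' z0 h j.+1 G C) ->
  staircase p'' c y0 h.+1 j g (bundle c v y0 e) T ->
  exists T', staircase p c y0 h.+1 j.+1 g (bundle c v y0 e) T'.
Proof.
move=> pp' p'p'' p''c cv j0 gG exC [uT locT forceT].
set low := bundle c v y0 e in uT forceT *.
have [t yt tS] := exists_above y0 (T ++ low).
have [C [uC locC forceC]] := exC t.
pose I := (p', c, t) : R * R * R.
have lS q : q \in T ++ low -> p'' < left_end q.
  rewrite mem_cat => /orP[/locT[]//|/bundleP[-> _ _]] //.
exists (C ++ I :: T); rewrite /staircase -catA cat_cons; split.
- rewrite cat_uniq uC cons_uniq uT andbT andTb; apply/andP; split.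
  + apply/hasPn => q; rewrite inE => /orP[/eqP ->|/lS lq].
      by apply/negP => /locC[]; rewrite /= /left_end /=; lra.
    by apply/negP => /locC[]; lra.
  + by apply/negP => /lS; rewrite /left_end /=; lra.
- move=> q; rewrite mem_cat inE => /or3P[/locC[]|/eqP ->|/locT[]].
  + by move=> *; split=> //; lra.
  + by rewrite /left_end /right_end /height /=; split=> //; lra.
  + by move=> *; split=> //; lra.
move=> P hit.
have [PI|nPI] := boolP (P I).
  right.
  (* Higher than [t], only members of [C] are left above the slot. *)
  have [x y|a [aI ca ha]] := forceC P.
    rewrite inE /= in_itv /= => /andP[px xp] ty cC.
    have nS q : q \in I :: T ++ low -> ~~ covers x y q.
      rewrite inE /covers /meets => /orP[/eqP ->|/lS lq];
      by apply/negP => /andP[/andP[]]; rewrite /height /=; lra.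
    have := hit x y; rewrite inE /= in_itv /= count_cat cC (count0_in nS) addn0.
    have -> : (p < x <= c) by apply/andP; split; lra.
    have -> : y0 < y by lra.
    move=> /(_ isT isT erefl); rewrite has_cat => /orP[//|/hasP[q qS /andP[_ cq]]].
    by have := nS _ qS; rewrite cq.
  move: aI; rewrite inE /= in_itv /= => /andP[pa ap].
  have nS q : q \in T ++ low -> ~~ meets a q.
    by move=> /lS lq; apply/negP => /andP[]; lra.
  have nS' q : q \in T ++ low -> ~~ predI P (meets a) q.
    by move=> /nS; apply: contra => /andP[].
  have mI : meets a I by apply/andP; rewrite /left_end /right_end /=; split; lra.
  exists a; rewrite inE /= in_itv /= !count_cat /= (count0_in nS) (count0_in nS').
  rewrite mI PI /= addn0; split; first by apply/andP; split; lra.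
    by rewrite -addnA; apply: leq_trans ca; rewrite leq_add2l.
  by rewrite addn1 ltnS.
(* A point of depth [j > 0] in the old staircase is lower than [I], so it gets
   depth [j + 1], and its hit is not [I]. *)
have [x y|lowP|[a [aI ca ha]]] := forceT P.
- rewrite inE /= in_itv /= => /andP[px xc] yy cS.
  have yt' : y < t.
    have : has (covers x y) (T ++ low) by rewrite has_count cS.
    by case/hasP => q /tS qt /andP[_]; lra.
  have nC q : q \in C -> ~~ covers x y q.
    by move=> /locC[] *; apply/negP => /andP[/andP[]]; lra.
  have cI : covers x y I.
    rewrite /covers /meets /left_end /right_end /height /=.
    by rewrite xc (ltW yt') !andbT; lra.
  have := hit x y; rewrite inE /= in_itv /= count_cat /= (count0_in nC) cI cS add0n.
  have -> : (p < x <= c) by apply/andP; split; lra.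
  move=> /(_ isT yy erefl); rewrite has_cat /= (negbTE nPI) /=.
  by case/orP => // /hasP[q /nC nq /andP[_]]; rewrite (negbTE nq).
- by left.
- right; exists a; move: aI; rewrite inE /= in_itv /= => /andP[pa ac].
  have nC q : q \in C -> ~~ meets a q.
    by move=> /locC[] *; apply/negP => /andP[]; lra.
  rewrite inE /= in_itv /= 2!count_cat /= (count0_in nC).
  split; first by apply/andP; split; lra.
    by rewrite add0n -addnA -add1n leq_add // leq_b1.
  by apply: leq_trans ha _; rewrite addnA leq_addl.
Qed.

(** The copy used with [j] central rectangles is an [F(h, j)] with [j] above [e];
    its deficit [G] must exceed [g] to pay for the step under it. *)
Lemma staircase_exists (R : realType) (c v y0 : R) (h g G e k : nat) :
  c <= v -> (0 < e)%N -> (g < G)%N ->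
  (forall j x0 x1 z0, (e <= j)%N -> x0 < x1 ->
     exists C, forcing (R := R) x0 x1 z0 h j G C) ->
  forall p, p < c ->
  exists T, staircase p c y0 h.+1 (k + e) g (bundle c v y0 e) T.
Proof.
move=> cv e0 gG exC; elim: k => [|k IH] p pc.
  by exists [::]; apply: staircase0.
pose p' := (2 * p + c) / 3; pose p'' := (p + 2 * c) / 3.
have [T sT] : exists T, staircase p'' c y0 h.+1 (k + e) g (bundle c v y0 e) T.
  by apply: IH; rewrite /p''; lra.
rewrite addSn; apply: (@staircase_step R p p' p'' c v y0 h (k + e) g G e T) => //;
  rewrite /p' /p''; try lra; first by lia.
by move=> z0; apply: exC; [lia | lra].
Qed.

(** * The induction *)

(** The right part: the bundle runs under a copy [C] of [F(h, d)] over the slot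
    from [u] to [v]. The condition [e + g <= K] says that the deficit [K] of
    [C] pays for the whole bundle. *)
Lemma forcing_step (R : realType) (x0 x1 y0 : R) (h d e g G K : nat) :
  x0 < x1 -> (0 < e <= d)%N -> (g < G)%N -> (e + g <= K)%N ->
  (forall j z0 z1 w0, (e <= j)%N -> z0 < z1 ->
     exists C, forcing (R := R) z0 z1 w0 h j G C) ->
  (forall z0 z1 w0, z0 < z1 -> exists C, forcing (R := R) z0 z1 w0 h d K C) ->
  exists s, forcing x0 x1 y0 h.+1 d g s.
Proof.
move=> x01 /andP[e0 ed] gG egK exC exK.
pose c := (3 * x0 + x1) / 4; pose u := (x0 + x1) / 2; pose v := (x0 + 3 * x1) / 4.
have xc : x0 < c by rewrite /c; lra.
have cu : c < u by rewrite /c /u; lra.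
have uv : u < v by rewrite /v /u; lra.
have vx : v < x1 by rewrite /v; lra.
have cv : c <= v by lra.
have [T] := @staircase_exists R c v y0 h g G e (d - e) cv e0 gG exC x0 xc.
rewrite subnK //; set low := bundle c v y0 e => -[uT locT forceT].
have [t yt tl] := exists_above y0 low.
have [C [uC locC forceC]] := exK u v t uv.
have lS q : q \in T ++ low -> left_end q <= c.
  by rewrite mem_cat => /orP[/locT[]|/bundleP[-> _ _]] //; lra.
exists ((T ++ low) ++ C); split.
- rewrite cat_uniq uT uC andbT /=; apply/hasPn => q /locC[] *.
  by apply/negP => /lS; lra.
- move=> q; rewrite 2!mem_cat => /orP[/orP[/locT[]|/bundleP[]]|/locC[]].
  + by move=> *; split=> //; lra.
  + by rewrite /located => -> -> ?; split=> //; lra.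
  + by move=> *; split=> //; lra.
move=> P hit.
have nC x : x <= c -> forall q, q \in C -> ~~ meets x q.
  by move=> xc' q /locC[] *; apply/negP => /andP[]; lra.
have nT x : u < x -> forall q, q \in T -> ~~ meets x q.
  by move=> ux q /locT[] *; apply/negP => /andP[]; lra.
(* The three cases: the hypothesis of the staircase, a hit [J] in the bundle, and
   a line found by the staircase, out of the reach of [C]. *)
have [x y|/hasP[J Jl PJ]|[a [aI ca ha]]] := forceT P.
- rewrite inE /= in_itv /= => /andP[px xc'] yy cS.
  have nCx q : q \in C -> ~~ covers x y q.
    by move=> /(nC _ xc'); apply: contra => /andP[].
  have := hit x y; rewrite inE /= in_itv /= count_cat cS (count0_in nCx) addn0.
  have -> : (x0 < x < x1) by apply/andP; split; lra.
  move=> /(_ isT yy erefl); rewrite has_cat => /orP[//|/hasP[q /nCx nq /andP[_]]].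
  by rewrite (negbTE nq).
- have [x y|a [aI ca ha]] := forceC P.
    rewrite inE /= in_itv /= => /andP[ux xv] ty cC.
    have nS q : q \in T ++ low -> ~~ covers x y q.
      rewrite mem_cat => /orP[/(nT _ ux)|/tl qt].
        by apply: contra => /andP[].
      by apply/negP => /andP[_]; lra.
    have := hit x y; rewrite inE /= in_itv /= count_cat cC (count0_in nS) add0n.
    have -> : (x0 < x < x1) by apply/andP; split; lra.
    have -> : y0 < y by lra.
    move=> /(_ isT isT erefl); rewrite has_cat => /orP[/hasP[q /nS nq /andP[_]]|//].
    by rewrite (negbTE nq).
  move: aI; rewrite inE /= in_itv /= => /andP[ua av].
  have ml q : q \in low -> meets a q.
    by move=> /bundleP[lq rq _]; rewrite /meets lq rq; apply/andP; split; lra.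
  exists a; rewrite inE /= in_itv /= !count_cat (count0_in (nT _ ua)).
  rewrite (countT_in ml) size_map size_iota; split.
  + by apply/andP; split; lra.
  + rewrite add0n addnAC addnC; apply: leq_trans ca.
    by rewrite leq_add2l.
  + have : (0 < count (predI P (meets a)) low)%N.
      by rewrite -has_count; apply/hasP; exists J => //=; rewrite PJ ml.
    by move=> low0; rewrite -add1n leq_add // addn_gt0 low0 orbT.
- exists a; move: aI; rewrite inE /= in_itv /= => /andP[xa ac].
  rewrite inE /= in_itv /= count_cat (count0_in (nC _ (ltW ac))) addn0.
  split; [by apply/andP; split; lra | done | ].
  by apply: leq_trans ha _; rewrite [leqRHS]count_cat leq_addr.
Qed.

(** From [N] to [4 * N ^ 2]: the bundle takes half of the deficit [d %/ N], so [e]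
    is [d %/ (2 * N)]; the copies on the left then have deficit at least
    [e %/ N = d %/ (2 * N ^ 2)], and halving once more leaves room for the single
    rectangle under the copy. The bound on [d] also ensures that [e], the
    smallest parameter in use, is within reach of the induction hypothesis. *)
Lemma forcing_exists (R : realType) (h : nat) :
  exists N D : nat, (0 < N)%N /\ forall d (x0 x1 y0 : R), (D <= d)%N -> x0 < x1 ->
    exists s, forcing x0 x1 y0 h d (d %/ N) s.
Proof.
elim: h => [|h [N [D [N0 IH]]]].
  (* For [h = 0] the empty family has the largest possible deficit, [d] itself. *)
  exists 1%N, 0%N; split=> // d x0 x1 y0 _ x01; exists [::]; split=> // P _.
  exists ((x0 + x1) / 2); rewrite inE /= in_itv /= divn1; split=> //.
  by apply/andP; split; lra.
exists (4 * N ^ 2)%N, (4 * N ^ 2 + 2 * N * D)%N.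
have N20 : (0 < N ^ 2)%N by rewrite expn_gt0 N0.
have NN2 : (N <= N ^ 2)%N by rewrite -mulnn leq_pmulr.
split=> [|d x0 x1 y0 dD x01]; first by rewrite muln_gt0.
pose e := (d %/ (2 * N))%N.
have eD : (D <= e)%N.
  by rewrite leq_divRL ?muln_gt0 //; apply: leq_trans dD; rewrite mulnC leq_addl.
have d4 : (4 * N ^ 2 <= d)%N by apply: leq_trans dD; rewrite leq_addr.
have e0 : (0 < e)%N by rewrite divn_gt0 ?muln_gt0 //; lia.
have ed : (e <= d)%N by apply: leq_div.
have gG : (d %/ (4 * N ^ 2) < e %/ N)%N.
  have -> : (e %/ N = d %/ (2 * N ^ 2))%N by rewrite /e -divnMA -mulnA mulnn.
  have : (d %/ (4 * N ^ 2) * 2 <= d %/ (2 * N ^ 2))%N.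
    rewrite leq_divRL -?mulnA ?(mulnA 2 2)%N; last by rewrite muln_gt0.
    exact: leq_trunc_div.
  have : (0 < d %/ (4 * N ^ 2))%N by rewrite divn_gt0 ?d4 // muln_gt0.
  by clear; lia.
have egK : (e + d %/ (4 * N ^ 2) <= d %/ N)%N.
  have : (d %/ (4 * N ^ 2) <= e)%N.
    apply: leq_div2l; first by rewrite muln_gt0.
    by rewrite leq_mul.
  have : (e * 2 <= d %/ N)%N.
    by rewrite leq_divRL // -mulnA; apply: leq_trunc_div.
  by clear; lia.
apply: (@forcing_step R x0 x1 y0 h d e _ (e %/ N) (d %/ N)) => //.
- by rewrite e0.
- move=> j z0 z1 w0 ej z01; have [|C [uC lC fC]] := IH j z0 z1 w0 _ z01; first lia.
  exists C; split=> // P /fC [a [aI ca ha]]; exists a; split=> //.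
  by have := leq_div2r N ej; lia.
- by move=> z0 z1 w0 z01; apply: IH => //; lia.
Qed.

(** * From triples to point sets *)

Definition rectangle (R : realType) (q : R * R * R) : set (R * R) :=
  [set p | left_end q <= p.1 <= right_end q /\ p.2 <= height q].

(** Without the order of the ends this fails: all reversed triples give the
    empty set. *)
Lemma rectangle_inj (R : realType) (q q' : R * R * R) :
  left_end q <= right_end q -> left_end q' <= right_end q' ->
  rectangle q = rectangle q' -> q = q'.
Proof.
suff sub (r r' : R * R * R) : left_end r <= right_end r ->
    rectangle r = rectangle r' ->
    [/\ left_end r' <= left_end r, right_end r <= right_end r'
      & height r <= height r'].
  move=> lr lr' E; have [l1 r1 h1] := sub _ _ lr E.
  have [l2 r2 h2] := sub _ _ lr' (esym E).
  case: q q' {lr lr' E} l1 r1 h1 l2 r2 h2 => [[l r] t] [[l' r'] t'].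
  rewrite /left_end /right_end /height /= => *.
  by congr (_, _, _); lra.
move=> lr E.
have : rectangle r' (left_end r, height r).
  by rewrite -E /rectangle /= lexx lr; split.
have : rectangle r' (right_end r, height r).
  by rewrite -E /rectangle /= lexx lr; split.
by rewrite /rectangle /= => -[/andP[_ ->] _] [/andP[-> _] ->].
Qed.

Lemma card_fset_filter_map (T : eqType) (U : choiceType) (f : T -> U)
    (s : seq T) (X : {fset U}) (p : pred T) :
  uniq s -> {in s &, injective f} ->
  (forall A, A \in X <-> exists q, [/\ q \in s, p q & A = f q]) ->
  #|` X| = count p s.
Proof.
move=> us fi XE.
have -> : X = [fset A in [seq f q | q <- s & p q]]%fset.
  apply/fsetP => A; rewrite in_fsetE; apply/idP/mapP => [/XE[q [qs pq ->]]|].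
    by exists q => //; rewrite mem_filter pq.
  by case=> q; rewrite mem_filter => /andP[pq qs] ->; apply/XE; exists q.
rewrite card_fseq undup_id ?size_map ?size_filter //.
rewrite map_inj_in_uniq ?filter_uniq // => q q'.
by rewrite !mem_filter => /andP[_ qs] /andP[_ qs']; apply: fi.
Qed.

Lemma line_meets_rectangle (R : realType) (a : R) q :
  (vertical_line a `&` rectangle q !=set0) <-> meets a q.
Proof.
split=> [[[x y] []]|m]; rewrite /vertical_line /rectangle /=.
  by move=> -> [].
by exists (a, height q); split.
Qed.

Theorem theorem4p1 (R : realType) (h : nat) :
  exists (r : R) (D : nat),
    [/\ r < 1, (1 <= D)%N &
      forall d : nat, (D <= d)%N ->
      exists F : {fset set (R * R)},
        (forall A, A \in F -> bottomless_rectangle A) /\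
        forall H : {fset set (R * R)}, hits_d_cells d F H ->
        exists a : R,
          (#|` members_meeting (vertical_line a) F|%:Z
             <= Num.ceil (r * d%:R)) /\
          (h <= #|` members_meeting (vertical_line a) H|)%N].
Proof.
have [N [D [N0 exF]]] := forcing_exists R h.
have NR : 0 < N%:R :> R by rewrite ltr0n.
exists (1 - N%:R^-1), D.+1; split=> //.
  by rewrite ltrBlDr ltrDl invr_gt0.
move=> d Dd.
have [s [us ls force]] := exF d 0 1 0 (ltnW Dd) ltr01.
have inj : {in s &, injective (@rectangle R)}.
  by move=> q q' /ls[_ lr _ _] /ls[_ lr' _ _]; apply: rectangle_inj.
pose F := [fset A in [seq rectangle q | q <- s]]%fset.
have FP A : A \in F <-> exists2 q, q \in s & A = rectangle q.
  by rewrite in_fsetE; split=> [/mapP|/mapP].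
exists F; split=> [A /FP[q _ ->]|H [/fsubsetP HF hitH]].
  by exists (left_end q), (right_end q), (height q).
have [x y _ _ cd|a [_ ca ha]] := force (fun q => rectangle q \in H).
  have [|A AH Axy] := hitH (x, y).
    rewrite /d_cells /= -cd; apply: (card_fset_filter_map us inj) => A.
    rewrite /members_covering in_fsetE /=; split.
      move=> /andP[/FP[q qs ->]]; rewrite inE => -[m hy].
      by exists q; split=> //; rewrite /covers /meets m.
    move=> [q [qs /andP[m hy] ->]]; apply/andP; split; last by rewrite inE; split.
    by apply/FP; exists q.
  have /FP[q qs Aq] := HF _ AH; subst A.
  by apply/hasP; exists q => //=; rewrite AH; case: Axy => /= m hy; apply/andP.
exists a; split.
  have -> : #|` members_meeting (vertical_line a) F| = count (meets a) s.
    apply: (card_fset_filter_map us inj) => A; rewrite /members_meeting in_fsetE /= inE /=.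
    split=> [/andP[/FP[q qs ->] /asboolP /line_meets_rectangle m]|[q [qs m ->]]].
      by exists q.
    apply/andP; split; first by apply/FP; exists q.
    exact/asboolP/line_meets_rectangle.
  have {}ca : (count (meets a) s <= d - d %/ N)%N by lia.
  apply: (@le_trans _ _ (d - d %/ N)%N%:Z); first by rewrite lez_nat.
  (* It suffices that [d - d %/ N - 1 < d - d / N], so no case on divisibility. *)
  have qd := leq_div d N; have := ltn_ceil d N0.
  rewrite -(ltr_nat R) natrM -natr1 => dq.
  rewrite -[X in X <= _](subrK 1) lezD1 ceil_gt_int intrB -pmulrn natrB //.
  have : d%:R / N%:R < (d %/ N)%:R + 1 :> R by rewrite ltr_pdivrMr.
  lra.
apply: leq_trans ha _.
suff -> : #|` members_meeting (vertical_line a) H| =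
  count (predI (fun q => rectangle q \in H) (meets a)) s by [].
apply: (card_fset_filter_map us inj) => A; rewrite /members_meeting in_fsetE /= inE /=.
split=> [/andP[AH /asboolP m]|[q [qs /andP[qH m] ->]]].
  have /FP[q qs Aq] := HF _ AH; subst A.
  by exists q; split=> //=; rewrite AH; apply/line_meets_rectangle.
by apply/andP; split=> //; apply/asboolP/line_meets_rectangle.
Qed.
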